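(* Let $\Lambda\subset\mathbb{C}$ be open, connected and non-empty, and let $X$ be a complex Hilbert space. Let $A(\cdot)\colon\Lambda\to L(X)$ be a holomorphic Fredholm operator function with non-empty resolvent set, and let $(X_n)_{n\in\mathbb{N}}$ be a sequence of closed subspaces of $X$ with orthogonal projections $P_n$ onto $X_n$ such that $\lim_{n\to\infty}\|u-P_nu\|_X=0$ for all $u\in X$. Let $A_n(\cdot)\colon\Lambda\to L(X_n)$ be the Galerkin approximation of $A(\cdot)$ defined by $A_n(\lambda):=P_nA(\lambda)|_{X_n}$ for each $\lambda\in\Lambda$. Assume that $A_n(\lambda)$ is Fredholm with index zero for each $\lambda\in\Lambda$ and $n\in\mathbb{N}$, and that $(A_n(\cdot))_{n\in\mathbb{N}}$ is regular. Let $\tilde\Lambda\subset\Lambda$ be a compact set with rectifiable boundary $\partial\tilde\Lambda\subset\rho(A(\cdot))$ and $\tilde\Lambda\cap\sigma(A(\cdot))=\{\lambda_0\}$. Then there exist $n_0\in\mathbb{N}$ and $c>0$ such that for all $n>n_0$ $$\inf_{u_0\in\ker A(\lambda_0)}\|u_n-u_0\|_X\leq c\Big(|\lambda_n-\lambda_0|+\max_{\substack{u_0'\in\ker A(\lambda_0)\\ \|u_0'\|_X\leq 1}}\ \inf_{u_n'\in X_n}\|u_0'-u_n'\|_X\Big)$$ for all $\lambda_n\in\sigma(A_n(\cdot))\cap\tilde\Lambda$ and all $u_n\in\ker A_n(\lambda_n)$ with $\|u_n\|_X=1$.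
   Context: $L(Y)$ denotes the bounded linear operators from a Hilbert space $Y$ to itself with the operator norm; $X_n$ carries the norm of $X$. An operator function $A(\cdot)\colon\Lambda\to L(X)$ is holomorphic if it is complex differentiable, and Fredholm if $A(\lambda)$ is Fredholm for each $\lambda\in\Lambda$. For an operator function $B(\cdot)$ on $\Lambda$, $\rho(B(\cdot)):=\{\lambda\in\Lambda: B(\lambda)\text{ is invertible}\}$ and $\sigma(B(\cdot)):=\Lambda\setminus\rho(B(\cdot))$. A sequence $(u_n\in X)_n$ is compact if every subsequence has a converging subsubsequence. A sequence $(B_n\in L(X_n))_n$ is regular if for every bounded sequence $(u_n\in X_n)_n$ the compactness of $(B_nu_n)_n$ implies the compactness of $(u_n)_n$. The sequence $(A_n(\cdot))_n$ is regular if $(A_n(\lambda))_n$ is regular for each $\lambda\in\Lambda$. *)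

(* Defs.v *)
From HB Require Import structures.
From mathcomp Require Import all_boot all_order all_algebra.
From mathcomp Require Import all_classical all_reals all_analysis.
From mathcomp Require Import complex.

Set Implicit Arguments.
Unset Strict Implicit.
Unset Printing Implicit Defensive.

Import Order.TTheory GRing.Theory Num.Theory.
Import numFieldNormedType.Exports.

Local Open Scope classical_set_scope.
Local Open Scope ring_scope.
Local Open Scope complex_scope.

(* The usual topology of the complex plane: the one MathComp-Analysis attaches
   to any abstract numFieldType. *)
HB.instance Definition _ (R : realType) :=
  NormedModule.copy R[i] (R[i] : numFieldType)^o.

(* Norms over R[i] take values in R[i] (they are nonnegative reals there);
   [rnorm] is the same number seen in R. *)
Definition rnorm (R : realType) (V : normedZmodType R[i]) (v : V) : R :=
  complex.Re `|v|.

Definition dist (R : realType) (X : normedModType R[i]) (u : X) (V : set X) : R :=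
  inf [set rnorm (u - v) | v in V].

Definition is_max (R : realType) (S : set R) (m : R) : Prop :=
  S m /\ ubound S m.

(* Together with completeness of X, this makes X a Hilbert space. *)
Definition hilbert_dot (R : realType) (X : normedModType R[i])
    (dot : {dot X for Num.conj}) : Prop :=
  forall u : X, `|u| ^+ 2 = dot u u.

Definition closed_subspace (R : realType) (X : normedModType R[i])
    (V : set X) : Prop :=
  closed V /\ submod_closed (mem V).

Definition orthogonal_projection (R : realType) (X : normedModType R[i])
    (dot : {dot X for Num.conj}) (V : set X) (P : X -> X) : Prop :=
  forall u : X, V (P u) /\ (forall v : X, V v -> dot (u - P u) v = 0).

(* An element of L(V), V a subspace of X, is represented by a function
   X -> X of which only the values on V matter; L(X) is the case V = setT. *)
Section OperatorsOnSubspaces.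
Context {R : realType} {X : normedModType R[i]}.
Implicit Types (V W : set X) (T S : X -> X).

Definition bounded_operator V T : Prop :=
  [/\ forall u, V u -> V (T u),
      forall (a : R[i]) (u v : X), V u -> V v -> T (a *: u + v) = a *: T u + T v
    & exists M : R, forall u, V u -> rnorm (T u) <= M * rnorm u].

Definition opnorm T : R := sup [set rnorm (T u) | u in [set u | rnorm u <= 1]].

Definition ker V T : set X := [set u | V u /\ T u = 0].

Definition invertible V T : Prop :=
  exists S, [/\ bounded_operator V S,
                forall u, V u -> S (T u) = u & forall u, V u -> T (S u) = u].

(* V / W has dimension k, for subspaces W `<=` V. *)
Definition quotient_dim V W (k : nat) : Prop :=
  exists e : 'I_k -> X,
    [/\ forall i, V (e i),
        forall a : 'I_k -> R[i], W (\sum_i a i *: e i) -> forall i, a i = 0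
      & forall u, V u -> exists a : 'I_k -> R[i], W (u - \sum_i a i *: e i)].

Definition fredholm_index V T (d : int) : Prop :=
  closed (T @` V) /\
  exists p q : nat, [/\ quotient_dim (ker V T) [set 0] p,
                        quotient_dim V (T @` V) q & d = p%:Z - q%:Z].

Definition fredholm V T : Prop := exists d : int, fredholm_index V T d.

Definition resolvent_set (L : set R[i]) V (B : R[i] -> X -> X) : set R[i] :=
  [set l | L l /\ invertible V (B l)].

Definition spectrum (L : set R[i]) V (B : R[i] -> X -> X) : set R[i] :=
  L `\` resolvent_set L V B.

(* Complex differentiability at each point of L for the operator norm. *)
Definition holomorphic (L : set R[i]) (A : R[i] -> X -> X) : Prop :=
  forall l, L l -> exists D : X -> X, bounded_operator setT D /\
    opnorm (fun u => (m - l)^-1 *: (A m u - A l u) - D u)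
      @[m --> l^'] --> (0 : R).

(* Compactness of a sequence: relative sequential compactness in X. *)
Definition compact_seq (u : nat -> X) : Prop :=
  forall f : nat -> nat, {homo f : m n / (m < n)%N} ->
  exists g : nat -> nat, {homo g : m n / (m < n)%N} /\
    cvgn (fun n => u (f (g n))).

Definition regular (V : nat -> set X) (B : nat -> X -> X) : Prop :=
  forall u : nat -> X, (forall n, V n (u n)) ->
  (exists M : R, forall n, rnorm (u n) <= M) ->
  compact_seq (fun n => B n (u n)) -> compact_seq u.

Definition galerkin (P : X -> X) (A : R[i] -> X -> X) : R[i] -> X -> X :=
  fun l u => P (A l u).

End OperatorsOnSubspaces.

Section RectifiableBoundary.
Context {R : realType}.

Definition boundary (K : set R[i]) : set R[i] := closure K `\` K°.

(* Length of the polygon with vertices g 0 and g s_i, i < size s. *)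
Definition polygon_length (g : R -> R[i]) (s : seq R) : R :=
  \sum_(0 <= n < size s) rnorm (g (nth 0 (0 :: s) n.+1) - g (nth 0 (0 :: s) n)).

Definition rectifiable_curve (g : R -> R[i]) : Prop :=
  {within `[0, 1], continuous g} /\
  has_ubound [set polygon_length g s | s in itv_partition 0 1].

(* The curves need not be closed, simple or disjoint. *)
Definition rectifiable_boundary (K : set R[i]) : Prop :=
  exists (k : nat) (g : 'I_k -> R -> R[i]),
    (forall i, rectifiable_curve (g i)) /\
    boundary K = \bigcup_i (g i @` `[0, 1]).

End RectifiableBoundary.

(* Main.v *)
Require Import Defs.
From mathcomp Require Import all_boot all_order all_algebra.
From mathcomp Require Import all_classical all_reals all_analysis.
From mathcomp Require Import complex lra.

Import Order.TTheory GRing.Theory Num.Theory.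
Import numFieldNormedType.Exports.

Local Open Scope classical_set_scope.
Local Open Scope ring_scope.
Local Open Scope complex_scope.

(** Put N = ker A(l0).  Regularity of P_n A(l0), used along subsequences, gives
    the following inf-sup bound: for large n, |P_n A(l0) y| >= eps for all y in
    X_n with |y| <= 3 and dist(y, N) >= 1/2.  Otherwise a subsequence of bad y's
    would converge to an element of N.

    For an eigenvector u of A_n(l) set d = dist(u, N), choose v in N with
    |u - v| < 2d, and apply the bound to y = (u - P_n v) / d.  As A(l0) v = 0,
    this yields d <= C (|P_n A(l0) u| + delta_n), where delta_n is the
    approximation error of the unit ball of N.  Finally
    P_n A(l0) u = P_n (A(l0) - A(l)) u is O(|l - l0|) near l0, and away from l0
    the claim follows from d <= 1. *)

(** * Extraction of subsequences *)

Lemma homo_choice (Q : nat -> nat -> Prop) :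
  (forall m k, exists n, (m < n)%N /\ Q n k) ->
  exists f : nat -> nat, {homo f : m n / (m < n)%N} /\ forall k, Q (f k) k.
Proof.
move=> H; pose c m k := xget 0%N [set n | (m < n)%N /\ Q n k].
have cP m k : (m < c m k)%N /\ Q (c m k) k.
  by rewrite /c; case: xgetP => [n _ //|/(_ _) no]; case: (H m k) => n /no.
(* Each value is chosen beyond the previous one, which makes [f] strictly increasing while
   [Q (f k) k] holds at every step. *)
pose f := fix f k := if k is k'.+1 then c (f k') k else c 0%N 0%N.
exists f; split; first by apply: (homo_ltn ltn_trans) => k; case: (cP (f k) k.+1).
by case=> [|k]; [case: (cP 0%N 0%N) | case: (cP (f k) k.+1)].
Qed.

Lemma homo_geq_id {f : nat -> nat} : {homo f : m n / (m < n)%N} ->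
  forall n, (n <= f n)%N.
Proof. by move=> hf; elim=> // n /leq_ltn_trans; apply; apply: hf. Qed.

Lemma cvg_homo {T : Type} {u : nat -> T} {F : set_system T} {f : nat -> nat} :
  {homo f : m n / (m < n)%N} -> u n @[n --> \oo] `=>` F ->
  u (f n) @[n --> \oo] `=>` F.
Proof.
move=> hf; apply: (cvg_comp f u) => B [N _ BN].
by exists N => // n /= Nn; apply: BN => /=; exact: leq_trans Nn (homo_geq_id hf n).
Qed.

(** * The norm read as a real number *)

Section Norm.
Context {R : realType} {V : normedZmodType R[i]}.
Implicit Types u v w : V.

Lemma rnormE v : `|v| = (rnorm v)%:C.
Proof. by rewrite /rnorm RRe_real ?normr_real. Qed.

Lemma rnorm_ge0 v : 0 <= rnorm v.
Proof. by rewrite -lecR -rnormE normr_ge0. Qed.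

Lemma rnorm_le u v : (`|u| <= `|v|) = (rnorm u <= rnorm v).
Proof. by rewrite !rnormE lecR. Qed.

Lemma rnorm0 : rnorm (0 : V) = 0.
Proof. by apply: complexI; rewrite -rnormE normr0. Qed.

Lemma rnorm_eq0 v : rnorm v = 0 -> v = 0.
Proof. by move=> v0; apply/eqP; rewrite -normr_eq0 rnormE v0. Qed.

Lemma rnorm_distC u v : rnorm (u - v) = rnorm (v - u).
Proof. by rewrite /rnorm distrC. Qed.

Lemma rnorm_triangle u v : rnorm (u + v) <= rnorm u + rnorm v.
Proof. by rewrite -lecR rmorphD/= -!rnormE; exact: ler_normD. Qed.

Lemma rnorm_triangleB w u v : rnorm (u - v) <= rnorm (u - w) + rnorm (w - v).
Proof. by apply: le_trans (rnorm_triangle _ _); rewrite addrA subrK. Qed.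

End Norm.

Lemma rnormZ {R : realType} {X : normedModType R[i]} (a : R[i]) (v : X) :
  rnorm (a *: v) = rnorm a * rnorm v.
Proof. by apply: complexI; rewrite rmorphM/= -!rnormE; exact: normrZ. Qed.

Lemma rnorm_realC {R : realType} (a : R) : 0 <= a -> rnorm (a%:C : R[i]) = a.
Proof. by move=> a0; rewrite /rnorm ger0_norm// ler0c. Qed.

Lemma cvg_rnorm {R : realType} {X : normedModType R[i]} (u : nat -> X) (l : X) :
  (u n @[n --> \oo] --> l) <-> (rnorm (u n - l) @[n --> \oo] --> (0 : R)).
Proof.
split=> [/cvgrPdist_lt ul|/cvgrPdist_lt ul]; apply/cvgrPdist_lt => e e0.
  have := ul e%:C; rewrite ltcR => /(_ e0); apply: filterS => n.
  by rewrite rnormE ltcR rnorm_distC sub0r normrN ger0_norm ?rnorm_ge0.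
(* Convergence in [X] quantifies over positive tolerances in [R[i]]; positivity there forces the
   tolerance to be real. *)
have /complex_realP[r er] := ger0_real (ltW e0); move: e0; rewrite er ltcR => r0.
have := ul r r0; apply: filterS => n.
by rewrite rnormE ltcR rnorm_distC sub0r normrN ger0_norm ?rnorm_ge0.
Qed.

Lemma cvg0_le {R : realType} (a b : nat -> R) : (forall n, 0 <= a n) ->
  (forall n, a n <= b n) -> b n @[n --> \oo] --> (0 : R) ->
  a n @[n --> \oo] --> (0 : R).
Proof.
move=> a0 ab; apply: (@squeeze_cvgr _ _ _ _ (fun=> 0)); last exact: cvg_cst.
by apply: nearW => n; rewrite a0 ab.
Qed.

(** * Distance to a set *)

Section Dist.
Context {R : realType} {X : normedModType R[i]} (V : set X).

Let dists u := [set rnorm (u - v) | v in V].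

Let dists_lb u : has_lbound (dists u).
Proof. by exists 0 => _ [v _ <-]; exact: rnorm_ge0. Qed.

Lemma dist_le (u v : X) : V v -> dist u V <= rnorm (u - v).
Proof. by move=> Vv; apply: (ge_inf (dists_lb u)); exists v. Qed.

Lemma le_dist (u : X) (m : R) : V !=set0 ->
  (forall v, V v -> m <= rnorm (u - v)) -> m <= dist u V.
Proof.
by move=> [w Vw] H; apply: lb_le_inf => [|_ [v /H ? <-]//]; exists (rnorm (u - w)), w.
Qed.

Lemma dist_lt (u : X) (m : R) : V !=set0 -> dist u V < m ->
  exists2 v, V v & rnorm (u - v) < m.
Proof.
move=> [w Vw] /inf_lt[|_ [v Vv <-] ?]; last by exists v.
by exists (rnorm (u - w)), w.
Qed.

Lemma dist_ge0 (u : X) : V !=set0 -> 0 <= dist u V.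
Proof. by move=> V0; apply: le_dist => // v _; exact: rnorm_ge0. Qed.

Lemma dist_lipschitz (u w : X) : V !=set0 -> dist u V <= rnorm (u - w) + dist w V.
Proof.
move=> V0; rewrite -lerBlDl; apply: le_dist => // v Vv.
by rewrite lerBlDl (le_trans (dist_le u _ Vv))// rnorm_triangleB.
Qed.

End Dist.

(** * Orthogonal projections *)

Section Projection.
Context {R : realType} {X : normedModType R[i]} {dot : {dot X for Num.conj}}.
Context (hdot : hilbert_dot dot).
Context {V : set X} {P : X -> X}.
Context (Vlin : forall (a : R[i]) (u v : X), V u -> V v -> V (a *: u + v)).
Context (P_proj : orthogonal_projection dot V P).

Let VB u v : V u -> V v -> V (u - v).
Proof. by move=> Vu Vv; rewrite addrC -scaleN1r; apply: Vlin. Qed.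

(** Pythagoras. It yields both the best approximation property of [P] and its contractivity. *)
Lemma orthogonal_rnorm_le (u v : X) : dot u v = 0 ->
  rnorm u <= rnorm (u + v) /\ rnorm v <= rnorm (u + v).
Proof.
move=> uv0; rewrite -!rnorm_le.
have H : `|u + v| ^+ 2 = `|u| ^+ 2 + `|v| ^+ 2 by rewrite !hdot hnormDd.
by split; rewrite -ler_sqr ?nnegrE// H ?lerDl ?lerDr exprn_ge0.
Qed.

Lemma proj_best (u v : X) : V v -> rnorm (u - P u) <= rnorm (u - v).
Proof.
move=> Vv; have [VP oP] := P_proj u.
have [] := orthogonal_rnorm_le (u - P u) (P u - v) (oP _ (VB _ _ VP Vv)).
by rewrite addrA subrK.
Qed.

Lemma proj_le (u : X) : rnorm (P u) <= rnorm u.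
Proof.
have [VP oP] := P_proj u.
by have [] := orthogonal_rnorm_le _ _ (oP _ VP); rewrite subrK.
Qed.

(** The difference [P u - x] lies in [V] and equals [(u - x) - (u - P u)], which is orthogonal to
    [V]; so it is orthogonal to itself. *)
Lemma proj_unique (u x : X) : V x ->
  (forall v, V v -> dot (u - x) v = 0) -> P u = x.
Proof.
move=> Vx ox; have [VP oP] := P_proj u; apply/eqP; rewrite -subr_eq0; apply/eqP.
apply: rnorm_eq0; apply/complexI; rewrite -rnormE; apply/eqP.
rewrite -sqrf_eq0 hdot; set z := P u - x; have Vz : V z by exact: VB.
have {1}-> : z = (u - x) - (u - P u) by rewrite opprB addrC /z addrA subrK.
have dotB a b : dot (a - b) z = dot a z - dot b z by exact: linearBl.
by rewrite dotB ox// oP// subrr.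
Qed.

(** Linearity is not part of [orthogonal_projection]; it follows from uniqueness, since
    [a *: P u + P v] satisfies the orthogonality that characterizes the projection. *)
Lemma projP (a : R[i]) (u v : X) : P (a *: u + v) = a *: P u + P v.
Proof.
have [VPu oPu] := P_proj u; have [VPv oPv] := P_proj v.
apply: proj_unique => [|w Vw]; first exact: Vlin.
have dotP b y z : dot (b *: y + z) w = b * dot y w + dot z w.
  exact: linearPl.
by rewrite opprD addrACA -scalerBr dotP oPu// oPv// mulr0 addr0.
Qed.

End Projection.

(** * Regularity along a subsequence of indices *)

Lemma regular_subseq {R : realType} {X : normedModType R[i]} {V : nat -> set X}
    {B : nat -> X -> X} {f : nat -> nat} {y : nat -> X} {M : R} :
  regular V B -> (forall n, V n 0) -> (forall n, B n 0 = 0) ->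
  {homo f : m n / (m < n)%N} -> (forall k, V (f k) (y k)) ->
  (forall k, rnorm (y k) <= M) ->
  rnorm (B (f k) (y k)) @[k --> \oo] --> (0 : R) ->
  exists g : nat -> nat, {homo g : m n / (m < n)%N} /\ cvgn (fun k => y (g k)).
Proof.
move=> reg V0 B0 hf Vy yM By.
have fI : injective f by apply: (inc_inj (f := f)); exact: leq_mono.
(* [y] sits on the range of [f]; elsewhere the sequence is filled up with 0. *)
pose u n := if pselect (exists k, f k = n) is left e then y (projT1 (cid e)) else 0.
have uf k : u (f k) = y k.
  rewrite /u; case: pselect => [e|[]]; last by exists k.
  by case: (cid e) => j /= /fI ->.
(* Case principle for the extended sequence: only the filler 0 and the values [y k] need
   checking. *)
have uP (Q : nat -> X -> Prop) n : Q n 0 -> (forall k, f k = n -> Q n (y k)) -> Q n (u n).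
  by move=> Q0 Qy; rewrite /u; case: pselect => // e; apply: Qy; case: (cid e).
have [|||g [hg cg]] := reg u _ _ _ f hf.
- by move=> n; apply: (uP (fun n => V n)) => // k <-.
- exists M => n; apply: (uP (fun _ w => rnorm w <= M)) => //.
  by rewrite rnorm0; exact: le_trans (rnorm_ge0 _) (yM 0%N).
- move=> h hh; exists id; split=> //; apply/cvg_ex; exists 0.
  apply: (cvg_homo (u := fun n => B n (u n)) hh); apply/cvg_rnorm.
  apply/cvgrPdist_lt => e e0; have [K _ HK] := proj1 (cvgrPdist_lt _ _) By e e0.
  (* For n at least [f K], either n is outside the range of [f] and the image is 0, or n is [f k]
     with k at least [K] by monotonicity. *)
  exists (f K) => // n /= fKn; rewrite subr0.
  have Q0 : `|0 - rnorm (0 : X)| < e by rewrite rnorm0 subrr normr0.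
  apply: (uP (fun n w => `|0 - rnorm (B n w)| < e)); first by rewrite B0.
  move=> k fk; rewrite -fk; apply: HK => /=; rewrite leqNgt; apply/negP => /hf.
  by rewrite fk ltnNge fKn.
exists g; split => //; move: cg.
by under [X in cvgn X]eq_fun do rewrite uf.
Qed.

(** * Galerkin sequences and the kernel of the limit operator *)

Section Galerkin.
Context {R : realType} {X : normedModType R[i]} {dot : {dot X for Num.conj}}.
Context (hdot : hilbert_dot dot).
Context {V : nat -> set X} {P : nat -> X -> X}.
Context (V0 : forall n, V n 0).
Context (Vlin : forall n (a : R[i]) (u v : X), V n u -> V n v -> V n (a *: u + v)).
Context (P_proj : forall n, orthogonal_projection dot (V n) (P n)).
Context (P_cvg : forall u : X, rnorm (u - P n u) @[n --> \oo] --> (0 : R)).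
Context {T : X -> X}.
Context (Tlin : forall (a : R[i]) (u v : X), T (a *: u + v) = a *: T u + T v).
Context {M : R} (M0 : 0 <= M) (TM : forall u, rnorm (T u) <= M * rnorm u).
Context (reg : regular V (fun n u => P n (T u))).

Let N := ker setT T.

Let VPn n u : V n (P n u). Proof. by case: (P_proj n u). Qed.

Let PB n u v : P n (u - v) = P n u - P n v.
Proof.
have := projP hdot (Vlin n) (P_proj n) (-1) v u.
by rewrite !scaleN1r ![- _ + _]addrC.
Qed.

Let P0 n : P n 0 = 0. Proof. by have := PB n 0 0; rewrite !subrr. Qed.

Let TB u v : T (u - v) = T u - T v.
Proof. by have := Tlin (-1) v u; rewrite !scaleN1r ![- _ + _]addrC. Qed.

Let T0 : T 0 = 0. Proof. by have := TB 0 0; rewrite !subrr. Qed.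

Lemma ker_linear (a : R[i]) (u v : X) : N u -> N v -> N (a *: u + v).
Proof. by move=> [_ Tu] [_ Tv]; split=> //; rewrite Tlin Tu Tv scaler0 add0r. Qed.

Let NN0 : N !=set0. Proof. by exists 0; split. Qed.

(** The norm of [T l] is at most the sum [b k] of three null sequences: the projection error of
    [T l], the term [M * rnorm (y k - l)] from contractivity of the projection, and the residual. *)
Lemma galerkin_limit (f : nat -> nat) (y : nat -> X) (l : X) :
  {homo f : m n / (m < n)%N} -> y k @[k --> \oo] --> l ->
  rnorm (P (f k) (T (y k))) @[k --> \oo] --> (0 : R) -> N l.
Proof.
move=> hf /cvg_rnorm yl Py; split=> //; apply: rnorm_eq0; apply/eqP.
rewrite eq_le rnorm_ge0 andbT.
pose b k := rnorm (T l - P (f k) (T l)) + M * rnorm (y k - l) + rnorm (P (f k) (T (y k))).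
have b0 : b k @[k --> \oo] --> 0.
  rewrite -[X in _ --> X]addr0; apply: cvgD => //.
  rewrite -[X in _ --> X]addr0; apply: cvgD; first exact: (cvg_homo hf (P_cvg _)).
  by rewrite -(mulr0 M); apply: cvgM => //; exact: cvg_cst.
apply: (cvgr_to_ge b0); apply: nearW => k; rewrite /b -lerBlDr.
have <- : P (f k) (T l) - P (f k) (T l - T (y k)) = P (f k) (T (y k)).
  by rewrite PB subKr.
rewrite lerBlDr; set Q := P (f k).
have := rnorm_triangle (T l - Q (T l)) (Q (T l)); rewrite subrK => /le_trans; apply.
rewrite -addrA lerD2l.
have := rnorm_triangle (Q (T l) - Q (T l - T (y k))) (Q (T l - T (y k))).
rewrite subrK [X in _ <= X -> _]addrC => /le_trans; apply.
rewrite lerD2r -TB; apply: le_trans (proj_le hdot (P_proj _) _) _.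
by rewrite rnorm_distC; exact: TM.
Qed.

Lemma galerkin_subseq (f : nat -> nat) (y : nat -> X) (C : R) :
  {homo f : m n / (m < n)%N} -> (forall k, V (f k) (y k)) ->
  (forall k, rnorm (y k) <= C) ->
  rnorm (P (f k) (T (y k))) @[k --> \oo] --> (0 : R) ->
  exists g l, [/\ {homo g : m n / (m < n)%N}, N l & y (g k) @[k --> \oo] --> l].
Proof.
move=> hf Vy yC By.
have [|g [hg /cvg_ex[/= l yl]]] := regular_subseq reg V0 _ hf Vy yC By.
  by move=> n; rewrite T0 P0.
exists g, l; split=> //; apply: (galerkin_limit (f \o g) _ l _ yl).
  by move=> m n /hg /hf.
exact: (cvg_homo (u := fun k => rnorm (P (f k) (T (y k)))) hg By).
Qed.

(* Regularity applied to [P (f k) (v k)], with [f] growing fast enough, makes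
   the finite dimension of the kernel unnecessary. *)
Lemma ker_ball_compact (v : nat -> X) :
  (forall k, N (v k)) -> (forall k, rnorm (v k) <= 1) ->
  exists g l, [/\ {homo g : m n / (m < n)%N}, N l, rnorm l <= 1 &
    v (g k) @[k --> \oo] --> l].
Proof.
move=> Nv v1.
have [|f [hf vf]] := homo_choice (fun n k => rnorm (v k - P n (v k)) <= k.+1%:R^-1).
  move=> m k; have := proj1 (cvgrPdist_le _ _) (P_cvg (v k)) k.+1%:R^-1.
  rewrite invr_gt0 ltr0n => /(_ _ isT) [n _ Hn]; exists (maxn m.+1 n).
  split; first exact: leq_maxl.
  by have := Hn (maxn m.+1 n) (leq_maxr _ _); rewrite sub0r normrN ger0_norm ?rnorm_ge0.
have vP0 : rnorm (v k - P (f k) (v k)) @[k --> \oo] --> (0 : R).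
  by apply: (cvg0_le _ _ _ vf) => [k|]; [exact: rnorm_ge0 | exact: cvg_harmonic].
have [|||g [l [hg Nl yl]]] := galerkin_subseq f (fun k => P (f k) (v k)) 1 hf.
- by move=> k; exact: VPn.
- by move=> k; apply: le_trans (v1 k); exact: (proj_le hdot (P_proj _)).
(* As [T (v k) = 0], the residual only sees [T] applied to the projection error of [v k]. *)
- apply: (cvg0_le _ (fun k => M * rnorm (v k - P (f k) (v k)))).
  + by move=> k; exact: rnorm_ge0.
  + move=> k; apply: le_trans (proj_le hdot (P_proj _) _) _.
    have [_ Tv0] := Nv k; have := TB (P (f k) (v k)) (v k).
    by rewrite Tv0 subr0 => <-; rewrite [X in _ * X]rnorm_distC; exact: TM.
  + by rewrite -(mulr0 M); apply: cvgM => //; exact: cvg_cst.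
have vl : rnorm (v (g k) - l) @[k --> \oo] --> (0 : R).
  apply: (cvg0_le _ _ _ (fun k => rnorm_triangleB (P (f (g k)) (v (g k))) _ _)).
    by move=> k; exact: rnorm_ge0.
  rewrite -[X in _ --> X]addr0; apply: cvgD; last exact/cvg_rnorm.
  exact: (cvg_homo (u := fun k => rnorm (v k - P (f k) (v k))) hg vP0).
exists g, l; split => //; last exact/cvg_rnorm.
have vl1 : rnorm (v (g k) - l) + 1 @[k --> \oo] --> (1 : R).
  by rewrite -[X in _ --> X]add0r; apply: cvgD => //; exact: cvg_cst.
apply: (cvgr_to_ge vl1); apply: nearW => k; rewrite rnorm_distC; have := rnorm_triangle (l - v (g k)) (v (g k)).
by rewrite subrK => /le_trans; apply; rewrite lerD2l.
Qed.

(** A maximizing sequence in the unit ball of the kernel has a convergent subsequence, and the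
    distance to [W] is 1-Lipschitz, so the supremum is attained at the limit. *)
Lemma ker_dist_max (W : set X) : W 0 ->
  exists delta : R,
    is_max [set dist u W | u in [set u | N u /\ rnorm u <= 1]] delta.
Proof.
move=> W0; set S := [set _ | _ in _]; have WN0 : W !=set0 by exists 0.
have S_sup : has_sup S.
  split; first by exists (dist 0 W), 0 => //; split=> //; rewrite rnorm0.
  exists 1 => _ [u [_ u1] <-]; apply: le_trans (dist_le _ _ _ W0) _.
  by rewrite subr0.
have /choice[v vP] k : exists v, [/\ N v, rnorm v <= 1 &
    sup S <= dist v W + k.+1%:R^-1].
  have [|_ [v [Nv v1] <-] /ltW] := @sup_adherent _ S k.+1%:R^-1 _ S_sup.
    by rewrite invr_gt0 ltr0n.
  by rewrite lerBlDr => H; exists v.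
have [||g [l [hg Nl l1 /cvg_rnorm vl]]] := ker_ball_compact v.
- by move=> k; case: (vP k).
- by move=> k; case: (vP k).
exists (dist l W); split; first by exists l.
suff sl : sup S <= dist l W.
  by move=> x Sx; apply: le_trans sl; exact: sup_upper_bound.
pose b k := rnorm (v (g k) - l) + dist l W + (g k).+1%:R^-1.
have bl : b k @[k --> \oo] --> dist l W.
  rewrite -[X in _ --> X]addr0; apply: cvgD.
    by rewrite -[X in _ --> X]add0r; apply: cvgD => //; exact: cvg_cst.
  exact: (cvg_homo (u := harmonic) hg cvg_harmonic).
apply: (cvgr_to_ge bl); apply: nearW => k; have [_ _ /le_trans] := vP (g k); apply.
by rewrite lerD2r; exact: dist_lipschitz.
Qed.

(** * Inf-sup bound and the resulting estimate of the distance to the kernel *)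

Lemma galerkin_inf_sup : exists (n0 : nat) (eps : R), 0 < eps /\
  forall n, (n0 < n)%N -> forall y, V n y -> rnorm y <= 3 -> 2^-1 <= dist y N ->
    eps <= rnorm (P n (T y)).
Proof.
apply: contrapT => no.
(* Negating the claim with threshold [m] and [eps] equal to 1/(k+1) gives bad vectors at arbitrarily
   large indices. *)
have [|f [hf /choice[y yP]]] := homo_choice (fun n k => exists y, [/\ V n y,
    rnorm y <= 3, 2^-1 <= dist y N & rnorm (P n (T y)) <= k.+1%:R^-1]).
  move=> m k; apply: contrapT => nok; apply: no; exists m, k.+1%:R^-1.
  split; first by rewrite invr_gt0 ltr0n.
  move=> n mn y Vy y3 dy; rewrite leNgt; apply/negP => /ltW Py.
  by apply: nok; exists n; split=> //; exists y.
have [|||g [l [hg Nl /cvg_rnorm yl]]] := galerkin_subseq f y 3 hf.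
- by move=> k; case: (yP k).
- by move=> k; case: (yP k).
- apply: (cvg0_le _ (fun k => k.+1%:R^-1)); [|by move=> k; case: (yP k)|].
    by move=> k; exact: rnorm_ge0.
  exact: cvg_harmonic.
(* The limit lies in [N], so the distances to [N], all at least 1/2, are bounded by a null
   sequence. *)
have : (2^-1 : R) <= 0.
  apply: (cvgr_to_ge yl); apply: nearW => k.
  by case: (yP (g k)) => _ _ /le_trans + _; apply; exact: dist_le.
by rewrite leNgt invr_gt0 ltr0n.
Qed.

Lemma galerkin_dist_ker : exists (n0 : nat) (c : R), 0 < c /\
  forall n, (n0 < n)%N -> forall delta,
    ubound [set dist u (V n) | u in [set u | N u /\ rnorm u <= 1]] delta ->
  forall u, V n u -> rnorm u <= 1 ->
    dist u N <= c * (rnorm (P n (T u)) + delta).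
Proof.
have [n0 [eps [eps0 He]]] := galerkin_inf_sup.
have C0 : 0 <= eps^-1 * (1 + 3 * M).
  by rewrite mulr_ge0 ?invr_ge0 ?(ltW eps0)// addr_ge0// mulr_ge0.
(* The summand 6 settles the case [d <= 6 * delta]; the other summand comes from the inf-sup
   bound. *)
exists n0, (6 + eps^-1 * (1 + 3 * M)); split; first by rewrite ltr_wpDr.
move=> n nn0 delta Hd u Vu u1.
have Vn0 : V n !=set0 by exists 0.
have delta0 : 0 <= delta.
  apply: le_trans (dist_ge0 _ 0 Vn0) (Hd _ _).
  by exists 0 => //; split=> //; rewrite rnorm0.
set r := rnorm _; have r0 : 0 <= r by exact: rnorm_ge0.
set d := dist u N.
have d1 : d <= 1 by apply: le_trans (dist_le _ _ 0 _) _; [split | rewrite subr0].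
(* In the second case [d] is positive and [3 * delta < d / 2], so replacing [v] by its projection
   costs less than half of [d]. *)
have [d6|d6] := lerP d (6 * delta).
  by apply: (le_trans d6); rewrite mulrDl; nra.
have d0 : 0 < d by nra.
have [v Nv uv] : exists2 v, N v & rnorm (u - v) < 2 * d.
  by apply: dist_lt => //; rewrite -/d; lra.
have v3 : rnorm v <= 3.
  have := rnorm_triangle (v - u) u; rewrite subrK rnorm_distC; lra.
have zN : N 0 by split.
have Tv0 : T v = 0 by case: Nv.
pose x := P n v.
have vx : rnorm (v - x) <= 3 * delta.
  (* Since [v] has norm at most 2d + 1 <= 3, the vector [v / 3] is in the unit ball of [N], where
     [delta] bounds the approximation error. *)
  pose w := (3^-1 : R)%:C *: v.
  have wd : rnorm (w - P n w) <= delta.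
    apply: le_trans (Hd (dist w (V n)) _).
      by apply: le_dist => // z; exact: (proj_best hdot (Vlin n) (P_proj n)).
    exists w => //; split; last by rewrite rnormZ rnorm_realC ?invr_ge0//; lra.
    by rewrite -[w]addr0; exact: ker_linear.
  have V3 : V n ((3 : R)%:C *: P n w) by rewrite -[_ *: _]addr0; exact: Vlin.
  apply: le_trans (proj_best hdot (Vlin n) (P_proj n) _ _ V3) _.
  have {1}-> : v = (3 : R)%:C *: w.
    by rewrite scalerA -rmorphM mulfV ?scale1r// pnatr_eq0.
  by rewrite -scalerBr rnormZ rnorm_realC//; lra.
pose w := u - x.
have Vw : V n w.
  by rewrite /w addrC -scaleN1r; apply: Vlin => //; exact: VPn.
have w3 : rnorm w <= 3 * d.
  have := rnorm_triangleB v u x; rewrite -/w; lra.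
pose y := (d^-1 : R)%:C *: w.
have dI0 : 0 <= d^-1 by rewrite invr_ge0 ltW.
have Hy : eps <= rnorm (P n (T y)).
  apply: He => //.
  - by rewrite /y -[_ *: _]addr0; exact: Vlin.
  - by rewrite rnormZ rnorm_realC// mulrC ler_pdivrMr.
  (* Adding [x - v] to [w - d z] gives [u - (d z + v)], of norm at least [d] because [d z + v] is in
     [N]; removing [x - v] leaves at least [d - 3 * delta], hence at least [d / 2]. *)
  - apply: le_dist => // z Nz.
    have -> : y - z = (d^-1 : R)%:C *: (w - d%:C *: z).
      by rewrite scalerBr scalerA -rmorphM mulVf ?scale1r// gt_eqF.
    rewrite rnormZ rnorm_realC// mulrC ler_pdivlMr//.
    have := dist_le N u _ (ker_linear d%:C z v Nz Nv); rewrite -/d.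
    have := rnorm_triangle (w - d%:C *: z) (x - v).
    rewrite rnorm_distC in vx.
    have -> : w - d%:C *: z + (x - v) = u - (d%:C *: z + v).
      by rewrite /w [u - x - _]addrAC addrA subrK opprD addrA.
    lra.
(* Here [T x = T (x - v)], so the contribution of [x] is at most [M * (3 * delta)]. *)
have Tw : rnorm (P n (T w)) <= r + 3 * M * delta.
  rewrite /w TB PB; apply: le_trans (rnorm_triangleB 0 _ _) _.
  rewrite subr0 [rnorm (0 - _)]rnorm_distC subr0 lerD2l.
  apply: le_trans (proj_le hdot (P_proj _) _) _.
  have := TB x v; rewrite Tv0 subr0 => <-; apply: le_trans (TM _) _.
  by rewrite rnorm_distC; have := ler_wpM2l M0 vx; lra.
have PTy : P n (T y) = (d^-1 : R)%:C *: P n (T w).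
  have := Tlin (d^-1 : R)%:C w 0; rewrite T0 !addr0 => ->.
  by have := projP hdot (Vlin n) (P_proj n) (d^-1 : R)%:C (T w) 0; rewrite P0 !addr0.
move: Hy; rewrite PTy rnormZ rnorm_realC// mulrC ler_pdivlMr// => /le_trans /(_ Tw).
rewrite mulrC -ler_pdivlMr// mulrC => /le_trans; apply.
have H : eps^-1 * (r + 3 * M * delta) <= eps^-1 * ((1 + 3 * M) * (r + delta)).
  rewrite ler_wpM2l ?invr_ge0 ?(ltW eps0)//.
  by have := mulr_ge0 M0 r0; rewrite mulrDl !mulrDr; lra.
apply: (le_trans H); rewrite mulrA ler_wpM2r//; first exact: addr_ge0.
by rewrite lerDr.
Qed.

End Galerkin.

(** * Operator norm and local Lipschitz continuity of holomorphic functions *)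

Section Operators.
Context {R : realType} {X : normedModType R[i]}.

Lemma bounded_operatorT {T : X -> X} : bounded_operator setT T ->
  (forall (a : R[i]) (u v : X), T (a *: u + v) = a *: T u + T v) /\
  exists2 M : R, 0 <= M & forall u, rnorm (T u) <= M * rnorm u.
Proof.
move=> [_ Tlin [M TM]]; split=> [a u v|]; first exact: Tlin.
exists `|M| => // u; apply: le_trans (TM u I) _.
by rewrite ler_wpM2r ?rnorm_ge0// ler_norm.
Qed.

(** [opnorm] is a real [sup], which bounds its set only when that set is bounded above; the first
    hypothesis supplies this. *)
Lemma le_opnorm {T : X -> X} {M : R} {u : X} :
  (forall u, rnorm u <= 1 -> rnorm (T u) <= M) -> rnorm u <= 1 ->
  rnorm (T u) <= opnorm T.
Proof.
move=> TM u1; apply: ub_le_sup; last by exists u.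
by exists M => _ [v /= v1 <-]; exact: TM.
Qed.

(** Near [l] the difference quotient differs from the derivative [D] by less than 1 in operator
    norm, so it is bounded by [1 + MD]. *)
Lemma holomorphic_lipschitz {L : set R[i]} {A : R[i] -> X -> X} {l : R[i]} :
  open L -> L l -> (forall m, L m -> bounded_operator setT (A m)) ->
  holomorphic L A ->
  exists r C : R, [/\ 0 < r, 0 <= C & forall m, rnorm (m - l) < r ->
    forall u, rnorm u <= 1 -> rnorm (A m u - A l u) <= C * rnorm (m - l)].
Proof.
move=> Lo Ll Ab /(_ l Ll)[D [/bounded_operatorT[_ [MD MD0 DM]]]].
move=> /cvgrPdist_lt/(_ 1 ltr01) near1.
have near2 : \forall m \near l^', L m.
  by apply: nbhs_dnbhs; exact: open_nbhs_nbhs.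
pose T m u := (m - l)^-1 *: (A m u - A l u) - D u.
have near12 : nbhs l [set m | m != l -> `|0 - opnorm (T m)| < 1 /\ L m].
  exact: filterI near1 near2.
have /nbhs_ballP[e /= e0 He] := near12.
have /complex_realP[r er] := ger0_real (ltW e0).
move: e0; rewrite er /= ltcR => r0.
exists r, (1 + MD); split=> // [|m ml u u1]; first exact: addr_ge0.
have [->|mNl] := eqVneq m l.
  by rewrite !subrr !rnorm0 mulr0.
have [] := He m _ mNl.
  by rewrite -ball_normE /= er rnormE ltcR rnorm_distC.
rewrite sub0r normrN => /ltW op1 Lm.
have [_ [Mm Mm0 AmM]] := bounded_operatorT (Ab m Lm).
have [_ [Ml Ml0 AlM]] := bounded_operatorT (Ab l Ll).
have ml0 : m - l != 0 by rewrite subr_eq0.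
have Tu1 : rnorm (T m u) <= 1.
  apply: le_trans (le_trans (ler_norm _) op1).
  (* This crude bound, depending on [m], only serves to make the supremum meaningful; the uniform
     bound 1 comes from [op1]. *)
  apply: (le_opnorm (M := rnorm (m - l)^-1 * (Mm + Ml) + MD)) => // v v1.
  have B0 (T' : X -> X) M' : 0 <= M' -> (forall w, rnorm (T' w) <= M' * rnorm w) ->
      rnorm (T' v) <= M'.
    by move=> M0 /(_ v) /le_trans; apply; rewrite ler_piMr.
  apply: le_trans (rnorm_triangleB 0 _ _) _.
  rewrite subr0 [rnorm (0 - _)]rnorm_distC subr0 rnormZ.
  apply: lerD; last exact: B0.
  apply: ler_wpM2l; first exact: rnorm_ge0.
  apply: le_trans (rnorm_triangleB 0 _ _) _.
  rewrite subr0 [rnorm (0 - _)]rnorm_distC subr0.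
  by apply: lerD; exact: B0.
have -> : A m u - A l u = (m - l) *: (T m u + D u).
  by rewrite subrK scalerA mulfV// scale1r.
rewrite rnormZ mulrC ler_wpM2r ?rnorm_ge0//.
apply: le_trans (rnorm_triangle _ _) _; apply: lerD => //.
by apply: le_trans (DM u) _; rewrite ler_piMr.
Qed.

End Operators.

(** * The eigenvector estimate *)

Theorem lemma2p6 (R : realType)
  (X : completeNormedModType R[i]) (dot : {dot X for Num.conj})
  (hdot : hilbert_dot dot)
  (Lambda : set R[i])
  (Lambda_open : open Lambda) (Lambda_conn : connected Lambda)
  (Lambda_neq0 : Lambda !=set0)
  (A : R[i] -> X -> X)
  (A_bounded : forall l, Lambda l -> bounded_operator setT (A l))
  (A_holo : holomorphic Lambda A)
  (A_fredholm : forall l, Lambda l -> fredholm setT (A l))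
  (A_resolvent : resolvent_set Lambda setT A !=set0)
  (Xn : nat -> set X) (Xn_closed : forall n, closed_subspace (Xn n))
  (P : nat -> X -> X)
  (P_proj : forall n, orthogonal_projection dot (Xn n) (P n))
  (P_cvg : forall u : X, rnorm (u - P n u) @[n --> \oo] --> (0 : R))
  (An : nat -> R[i] -> X -> X)
  (An_galerkin : An = fun n => galerkin (P n) A)
  (An_fredholm : forall l, Lambda l -> forall n, fredholm_index (Xn n) (An n l) 0)
  (An_regular : forall l, Lambda l -> regular Xn (fun n => An n l))
  (K : set R[i]) (K_sub : K `<=` Lambda) (K_compact : compact K)
  (K_rect : rectifiable_boundary K)
  (K_boundary : boundary K `<=` resolvent_set Lambda setT A)
  (l0 : R[i]) (K_spectrum : K `&` spectrum Lambda setT A = [set l0]) :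
  exists (n0 : nat) (c : R), 0 < c /\
    forall n : nat, (n0 < n)%N ->
    exists2 delta : R,
      is_max [set dist u0' (Xn n) | u0' in
               [set u0' | ker setT (A l0) u0' /\ rnorm u0' <= 1]] delta
    & forall (ln : R[i]) (un : X),
        (spectrum Lambda (Xn n) (An n) `&` K) ln ->
        ker (Xn n) (An n ln) un -> rnorm un = 1 ->
        dist un (ker setT (A l0)) <= c * (rnorm (ln - l0) + delta).
Proof.
have [_ [Ll0 _]] : (K `&` spectrum Lambda setT A) l0 by rewrite K_spectrum.
have X0 n : Xn n 0.
  by have [_ [+ _]] := Xn_closed n; rewrite inE.
have Xlin n (a : R[i]) (u v : X) : Xn n u -> Xn n v -> Xn n (a *: u + v).
  have [_ [_ +]] := Xn_closed n => /(_ a u v) + Xu Xv.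
  by rewrite !inE; exact.
have [Alin [M M0 AM]] := bounded_operatorT (A_bounded l0 Ll0).
have reg : regular Xn (fun n u => P n (A l0 u)).
  by have := An_regular l0 Ll0; rewrite An_galerkin.
have [r [C [r0 C0 AC]]] := holomorphic_lipschitz Lambda_open Ll0 A_bounded A_holo.
have [n0 [c [c0 Hc]]] := galerkin_dist_ker hdot X0 Xlin P_proj P_cvg Alin M0 AM reg.
(* The summand [c * (1 + C)] serves [ln] within [r] of [l0], where the Lipschitz bound applies;
   [r^-1] serves the remaining [ln]. *)
exists n0, (c * (1 + C) + r^-1); split.
  by rewrite addr_gt0 ?invr_gt0// mulr_gt0// ltr_wpDr.
move=> n nn0.
have [delta Hdelta] :=
  ker_dist_max hdot X0 Xlin P_proj P_cvg Alin AM reg (Xn n) (X0 n).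
exists delta => // ln un [[Lln _] _] [Xun]; rewrite An_galerkin => Aun un1.
have A00 : A l0 0 = 0.
  by have := Alin (-1) 0 0; rewrite scaler0 addr0 scaleN1r addNr.
have delta0 : 0 <= delta.
  have Xne : Xn n !=set0 by exists 0.
  apply: le_trans (dist_ge0 _ 0 Xne) (proj2 Hdelta _ _).
  by exists 0 => //; split=> //; rewrite rnorm0.
set t := rnorm (ln - l0); have t0 : 0 <= t by exact: rnorm_ge0.
have rI0 : 0 <= r^-1 by rewrite invr_ge0 ltW.
(* Away from [l0], the distance is at most the norm of [un], and 1 is at most [r^-1 * t]. *)
have [rt|tr] := lerP r t.
  apply: le_trans (dist_le _ _ 0 _) _ => //.
  rewrite subr0 un1.
  have rt1 : 1 <= r^-1 * t by rewrite mulrC ler_pdivlMr// mul1r.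
  have H1 : 0 <= r^-1 * delta by exact: mulr_ge0.
  have H2 : 0 <= c * (1 + C) * (t + delta).
    by rewrite !mulr_ge0 ?addr_ge0// ltW.
  by rewrite mulrDl mulrDr; lra.
have un1' : rnorm un <= 1 by rewrite un1.
apply: le_trans (Hc n nn0 delta (proj2 Hdelta) un Xun un1') _.
have PAun : rnorm (P n (A l0 un)) <= C * t.
  have PD u v := projP hdot (Xlin n) (P_proj n) (-1) u v.
  have <- : P n (A l0 un - A ln un) = P n (A l0 un).
    by rewrite addrC -scaleN1r PD (Aun : P n (A ln un) = 0) scaler0 add0r.
  apply: le_trans (proj_le hdot (P_proj n) _) _.
  by rewrite rnorm_distC; exact: AC.
apply: (@le_trans _ _ (c * (1 + C) * (t + delta))); last first.
  by rewrite ler_wpM2r ?addr_ge0// lerDl.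
rewrite -mulrA ler_wpM2l ?(ltW c0)//.
by have := mulr_ge0 C0 delta0; rewrite mulrDl mul1r mulrDr; lra.
Qed.
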